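(* Let $(G,N)$ be an equal order pair such that $G$ is solvable and $N$ is nilpotent. Then the Fitting height of $G$ is at most $4$.
   Context: All groups are finite. If $G$ is a finite group and $N$ is a proper, nontrivial, normal subgroup of $G$, the pair $(G,N)$ is called an equal order pair if, for every $x \in G \setminus N$, all elements of the coset $xN$ have the same order as $x$. *)

(* Defs.v *)
From mathcomp Require Import all_boot all_fingroup all_solvable.

Set Implicit Arguments.
Unset Strict Implicit.
Unset Printing Implicit Defensive.

Import GroupScope.

Section EqualOrderPair.

Variable gT : finGroupType.
Implicit Types G N : {group gT}.

Definition equal_order_pair G N : Prop :=
  [/\ N <| G, N \proper G, N :!=: 1
    & forall x, x \in G :\: N -> forall y, y \in x *: N -> #[y] = #[x]].

End EqualOrderPair.

(* The upper Fitting series F_0(G) = 1, F_(n+1)(G) / F_n(G) = 'F(G / F_n(G)), *)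
(* built like the upper central series upper_central_at.                      *)
Definition fitting_series n (gT : finGroupType) (A : {set gT}) : {set gT} :=
  iter n (fun B => coset B @*^-1 'F(A / B)) 1.

(* The least n such that F_n(G) = G. As with nil_class, the default value     *)
(* #|G| is taken when there is no such n, i.e., when G is not solvable.       *)
Definition fitting_height (gT : finGroupType) (A : {set gT}) : nat :=
  index A (mkseq (fun n => fitting_series n A) #|A|).

Section FittingHeightTheory.

Variables (gT : finGroupType) (G : {group gT}).

Lemma fitting_series_ex n :
  exists2 H : {group gT}, H <| G & fitting_series n G = H.
Proof.
elim: n => [|n [H nHG eqH]]; first by exists 1%G; rewrite ?normal1.
exists (coset H @*^-1 'F(G / H))%G; last first.
  by rewrite /fitting_series iterS -/(fitting_series n G) eqH.
by rewrite -(quotientGK nHG) cosetpre_normal Fitting_normal.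
Qed.

Lemma fitting_seriesS n (H : {group gT}) : H <| G -> fitting_series n G = H ->
  solvable G -> H \proper G -> H \proper fitting_series n.+1 G.
Proof.
move=> nHG eqH solG ltHG.
rewrite /fitting_series iterS -/(fitting_series n G) eqH properE sub_cosetpre /=.
apply: contraL ltHG => sFH; rewrite properE normal_sub //= negbK.
have F1: 'F(G / H) = 1.
  apply/trivgP; apply: subset_trans (_ : coset H @*^-1 'F(G / H) / H \subset _).
    by rewrite cosetpreK.
  by apply: subset_trans (quotientS H sFH) _; rewrite trivg_quotient.
have := trivg_Fitting (quotient_sol H solG); rewrite F1 eqxx => /esym.
by rewrite -subG1 quotient_sub1 ?normal_norm.
Qed.

Lemma fitting_height_leq n : solvable G ->
  (fitting_height G <= n) = (fitting_series n G == G).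
Proof.
move=> solG.
have big k : (fitting_series k G == G) || (k < #|fitting_series k G|).
  elim: k => [|k /orP[/eqP eqG|ltk]]; first by rewrite cards1 orbT.
    have [H nHG eqH] := fitting_series_ex k.+1.
    have sG: G \subset H.
      rewrite -eqH /fitting_series iterS -/(fitting_series k G) eqG.
      by rewrite sub_cosetpre.
    by rewrite eqH eqEsubset normal_sub ?sG.
  have [H nHG eqH] := fitting_series_ex k.
  have [eqHG|neqHG] := eqVneq (H : {set gT}) G.
    have [K nKG eqK] := fitting_series_ex k.+1.
    have sG: G \subset K.
      rewrite -eqK /fitting_series iterS -/(fitting_series k G) eqH eqHG.
      by rewrite sub_cosetpre.
    by rewrite eqK eqEsubset normal_sub ?sG.
  have ltHG: H \proper G by rewrite properEneq neqHG normal_sub.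
  have := proper_card (fitting_seriesS nHG eqH solG ltHG).
  by rewrite -eqH orbC => /(leq_trans _)-> //; rewrite ltnS.
have up i j : i <= j -> fitting_series i G = G -> fitting_series j G = G.
  move=> /subnKC <- eqi; elim: (j - i) => [|k IHk]; first by rewrite addn0.
  have [K nKG eqK] := fitting_series_ex (i + k.+1).
  rewrite eqK; apply/eqP; rewrite eqEsubset normal_sub //= -eqK addnS.
  rewrite /fitting_series iterS -/(fitting_series (i + k) G) IHk.
  by rewrite sub_cosetpre.
have lastG : fitting_series #|G|.-1 G = G.
  have [H nHG eqH] := fitting_series_ex #|G|.-1.
  case/orP: (big #|G|.-1) => [/eqP //|]; rewrite eqH prednK ?cardG_gt0 // => leGH.
  by apply/eqP; rewrite eqEcard normal_sub.
set s := mkseq (fun n => fitting_series n G) #|G|.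
have Gs : gval G \in s.
  by apply/mapP; exists #|G|.-1; rewrite // mem_iota /= add0n prednK.
have ltG: fitting_height G < #|G|.
  by have:= Gs; rewrite -index_mem size_mkseq.
have eqh : fitting_series (fitting_height G) G = G.
  by have := nth_index 1 Gs; rewrite nth_mkseq.
apply/idP/eqP => [len|eqn]; first exact: up eqh.
rewrite leqNgt; apply/negP => lt.
have := before_find 1 (lt : n < find (pred1 (gval G)) s).
by rewrite nth_mkseq ?(ltn_trans lt) //= eqn eqxx.
Qed.

End FittingHeightTheory.

(* Main.v *)
Require Import Defs.
From mathcomp Require Import all_boot all_fingroup all_solvable.
From mathcomp Require Import mxrepresentation mxabelem.

Set Implicit Arguments.
Unset Strict Implicit.
Unset Printing Implicit Defensive.

Import GroupScope.

(** If x in G :\: N commutes with y in N of coprime order, then #[x * y] = #[x]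
forces y = 1. Hence, for R a Sylow r-subgroup of G, R / (N :&: R) acts
semiregularly on (the isomorphic image of) 'O_r^'(N), which is nontrivial unless
N is an r-group, so 'r_r(G / N) <= 1: a noncyclic abelian group has no faithful
irreducible representation. Let M be N when N is not of prime power order, and
'O_p(G) when N is a p-group: then H := G / M satisfies 'r('F(H)) <= 1. Each
'O_r(H) is thus cyclic or a 2-group with a cyclic subgroup of index 2, so its
Frattini quotient V is cyclic or of order at most 4, whence (Aut V)^`(2) = 1.
Therefore H^`(2) stabilises every 'O_r(H) / 'Phi('O_r(H)), which puts it inside
'F(H) as H is solvable. Now M and 'F(H) are nilpotent and H / 'F(H) is
metabelian, whence the bound 1 + 1 + 2. *)

Section Semiregular.

Variable gT : finGroupType.
Implicit Types E K P R : {group gT}.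

Lemma abelian_semiregular_cyclic E K :
    solvable K -> K :!=: 1 -> E \subset 'N(K) -> semiregular K E ->
  abelian E -> cyclic E.
Proof.
move=> solK ntK nKE regKE cEE.
have [M minM sMK]: {M : {group gT} | minnormal M E & M \subset K}.
  by apply: mingroup_exists; rewrite ntK.
have [nME ntM /is_abelemP[p _ abelM]] := minnormal_solvable minM sMK solK.
have irrM := elimT (abelem_mx_irrP abelM ntM nME) minM.
apply: (mx_faithful_irr_abelian_cyclic _ irrM cEE); apply: abelem_mx_faithful.
have regEM := semiregular_sym (semiregularS sMK (subxx E) regKE).
have [x Mx ntx] := trivgPn _ ntM; apply/trivgP.
by rewrite -(regEM x) ?inE ?ntx // setIS // -cent_set1 centS ?sub1set.
Qed.

Lemma semiregular_rank R K :
    solvable K -> K :!=: 1 -> R \subset 'N(K) -> semiregular K R ->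
  'r(R) <= 1.
Proof.
move=> solK ntK nKR regKR; have [p _ ->] := rank_witness R.
rewrite leqNgt; apply/negP=> /p_rank_geP[E /pnElemP[sER abelE dimE]].
have: cyclic E.
  apply: abelian_semiregular_cyclic solK ntK _ _ (abelem_abelian abelE).
    exact: subset_trans nKR.
  exact: semiregularS regKR.
by rewrite (abelem_cyclic abelE) dimE.
Qed.

Lemma semiregular_quotient P R K :
    R \subset 'N(P) -> R \subset 'N(K) -> P :&: K = 1 ->
    {in R :\: K, forall x, 'C_P[x] = 1} ->
  semiregular (P / K) (R / K).
Proof.
move=> nPR nKR tiPK regPR xK /setD1P[ntxK /morphimP[x nKx Rx def_xK]].
have notKx: x \notin K by apply: contra ntxK => Kx; rewrite def_xK /= coset_id.
have sXR: <[x]> \subset R by rewrite cycle_subG.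
have [nPX nKX] := (subset_trans sXR nPR, subset_trans sXR nKR).
rewrite {xK ntxK}def_xK -cent_cycle -quotient_cycle //=.
by rewrite -quotient_TI_subcent // cent_cycle regPR ?quotient1 // inE notKx.
Qed.

End Semiregular.

Section FittingCentralisers.

Variable gT : finGroupType.
Implicit Types A C G H Q W : {group gT}.

Lemma cent_sub_Fitting G : solvable G -> 'C_G('F(G)) \subset 'F(G).
Proof.
move=> solG; pose C := 'C_G('F(G))%G.
have nsCG: C <| G by rewrite /normal subsetIl normsI ?norms_cent ?gFnorm.
have [n Cn1] := derivedP _ (solvableS (subsetIl _ _) solG : solvable C).
suffices: C^`(0) \subset 'F(G) by [].
have: C^`(n) \subset 'F(G) by rewrite Cn1 sub1G.
(* C centralises C^`(n.+1) if it lies in 'F(G): then C^`(n) has class <= 2. *)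
elim: n {Cn1} => // n IHn sC'F; apply/IHn/Fitting_max.
  exact: gFnormal_trans.
apply: small_nil_class; apply: (@leq_trans 2) => //.
rewrite nil_class2 subsetI der_sub centsC /=.
apply: subset_trans (der_sub n C) _.
by apply: subset_trans (subsetIr _ _) (centS _).
Qed.

Lemma cents_pcore_Fitting pi G A :
    (forall p, prime p -> p \in pi -> A \subset 'C('O_p(G))) ->
  A \subset 'C('O_pi('F(G))).
Proof.
move=> cAO; rewrite centsC -(Sylow_gen 'O_pi('F(G))) gen_subG.
apply/bigcupsP=> P /SylowP[p p_pr /and3P[sPF pP _]].
have [-> | ntP] := eqsVneq P 1; first exact: sub1G.
have pi_p: p \in pi.
  have [_ p_dv_P _] := pgroup_pdiv pP ntP.
  by rewrite (pgroupP (pgroupS sPF (pcore_pgroup _ _))).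
rewrite centsC (subset_trans (cAO p p_pr pi_p)) // centS // -p_core_Fitting.
rewrite (sub_Hall_pcore (nilpotent_pcore_Hall p (Fitting_nil G))) //.
by apply: subset_trans sPF _; apply: pcore_sub.
Qed.

Lemma coprime_cent_Phi Q A :
    solvable Q -> coprime #|Q| #|A| -> [~: Q, A] \subset 'Phi(Q) ->
  A \subset 'C(Q).
Proof.
move=> solQ coQA sQAPhi.
have nQA: A \subset 'N(Q) by rewrite -commg_subl (subset_trans sQAPhi) ?Phi_sub.
have nPhiA: A \subset 'N('Phi(Q)) := gFnorm_trans _ nQA.
have defCQ: 'C_Q(A) / 'Phi(Q) = Q / 'Phi(Q).
  rewrite coprime_quotient_cent ?Phi_sub //; apply/setIidPl.
  by rewrite quotient_cents2r // commGC.
have: <<'C_Q(A)>> = Q.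
  apply: Phi_nongen; apply/eqP; rewrite eqEsubset join_subG Phi_sub subsetIl.
  rewrite norm_joinEr ?(subset_trans (subsetIl _ _)) ?gFnorm //=.
  by rewrite -quotientSK ?gFnorm ?defCQ.
by rewrite genGid => /setIidPl; rewrite centsC.
Qed.

Lemma nilpotent_cent_p'core_Fitting (p : nat) G C :
    solvable G -> C \subset 'C_G('O_p^'('F(G))) ->
    (forall H, H \subset C -> p^'.-group H -> H \subset 'C('O_p(G))) ->
  nilpotent C.
Proof.
move=> solG /subsetIP[sCG cCOp'] cp'Op; have nilF := Fitting_nil G.
have [H hallH] := Hall_exists p^' (solvableS sCG solG).
have [sHC p'H iH] := and3P hallH.
(* H centralises 'F(G), hence lies in 'O_p^'('F(G)), which C centralises. *)
have sHF: H \subset 'F(G).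
  apply: subset_trans (cent_sub_Fitting solG).
  rewrite subsetI (subset_trans sHC) //=.
  have [_ /= <- _ _] := dprodP (nilpotent_pcoreC p nilF).
  by rewrite centM subsetI /= p_core_Fitting cp'Op // (subset_trans sHC).
have sHZ: H \subset 'Z(C).
  rewrite subsetI sHC centsC (subset_trans cCOp') // centS //.
  by rewrite (sub_Hall_pcore (nilpotent_pcore_Hall _ nilF)).
rewrite -quotient_center_nil; apply: (pgroup_nil (p := p)).
rewrite /pgroup card_quotient ?gFnorm //.
by apply: pnat_dvd (indexgS C sHZ) _; rewrite pnatNK in iH.
Qed.

Lemma stab_pcore_Phi_sub_Fitting G W :
    solvable G -> W <| G ->
    (forall p, prime p -> [~: 'O_p(G), W] \subset 'Phi('O_p(G))) ->
  W \subset 'F(G).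
Proof.
move=> solG /andP[sWG nWG] stabW.
have cp'Op p H :
  prime p -> H \subset W -> p^'.-group H -> H \subset 'C('O_p(G)).
- move=> p_pr sHW p'H; apply: coprime_cent_Phi.
  + exact: pgroup_sol (pcore_pgroup p G).
  + exact: pnat_coprime (pcore_pgroup p G) p'H.
  exact: subset_trans (commgS _ sHW) (stabW p p_pr).
rewrite -(Sylow_gen W) gen_subG; apply/bigcupsP=> S /SylowP[p p_pr sylS].
have [sSW pS _] := and3P sylS; pose C := 'C_W('O_p^'('F(G)))%G.
have sCW: C \subset W := subsetIl _ _.
have sSC: S \subset C.
  rewrite subsetI sSW cents_pcore_Fitting // => q q_pr p'q.
  by apply: cp'Op => //; apply: pi_pgroup pS _; rewrite !inE eq_sym.
apply: subset_trans sSC (Fitting_max _ _).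
  rewrite /normal (subset_trans sCW) //.
  by rewrite normsI ?norms_cent ?gFnorm_trans ?gFnorm.
apply: (@nilpotent_cent_p'core_Fitting p G) => // [|H sHC]; first exact: setSI.
exact: cp'Op (subset_trans sHC sCW).
Qed.

End FittingCentralisers.

Section SecondDerivedSubgroup.

Implicit Types (gT : finGroupType) (p q : nat).

Lemma norm_Sylow_index_dvd_prime gT (G P : {group gT}) p q :
    prime p -> prime q -> q <= p -> p.-Sylow(G) P -> #|G : P| %| q ->
  G \subset 'N(P).
Proof.
move=> p_pr q_pr le_qp sylP iP; have sPG := pHall_sub sylP.
have mod_Syl := card_Syl_mod G p_pr.
have: #|'Syl_p(G)| %| q.
  apply: dvdn_trans iP.
  by rewrite (card_Syl sylP) indexgS // subsetI sPG normG.
have [_ dvd_q] := primeP q_pr; case/dvd_q/pred2P=> nSyl.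
  by move/eqP: nSyl; rewrite (card_Syl sylP) indexg_eq1 subsetI => /andP[].
move: le_qp mod_Syl; rewrite nSyl leq_eqVlt => /predU1P[-> | lt_qp].
  by rewrite modnn.
by rewrite modn_small // => q1; rewrite q1 in q_pr.
Qed.

Lemma der2_card_dvd_mul_prime gT (G : {group gT}) p q :
  prime p -> prime q -> #|G| %| p * q -> G^`(2) = 1.
Proof.
wlog le_qp: p q / q <= p => [IH p_pr q_pr | p_pr q_pr dvdG].
  by case: (leqP q p) => [/IH | /ltnW/IH]; [|rewrite mulnC]; apply.
have [P sylP] := Sylow_exists p G; have [sPG pP p'iP] := and3P sylP.
have iP: #|G : P| %| q.
  have co_iP_p: coprime #|G : P| p.
    by rewrite coprime_sym prime_coprime -?p'natE.
  by rewrite -(Gauss_dvdr _ co_iP_p) (dvdn_trans (dvdn_indexg _ _)).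
have cPP: abelian P.
  have pq_gt0: 0 < p * q by rewrite muln_gt0 !prime_gt0.
  have dvdP := dvdn_trans (cardSg sPG) dvdG.
  apply: p2group_abelian pP (leq_trans (dvdn_leq_log p pq_gt0 dvdP) _).
  by rewrite lognM ?prime_gt0 // !logn_prime // eqxx; case: eqP.
have nPG := norm_Sylow_index_dvd_prime p_pr q_pr le_qp sylP iP.
have sG1P: G^`(1) \subset P.
  apply: (der1_min nPG); apply/cyclic_abelian/(dvdn_prime_cyclic q_pr).
  by rewrite /= card_quotient.
apply/trivgP; apply: subset_trans (dergS 1 sG1P) _.
by rewrite (derG1P cPP).
Qed.

Lemma der2_Aut_card_le4 gT (V : {group gT}) : #|V| <= 4 -> (Aut V)^`(2) = 1.
Proof.
move=> leV4; apply: (der2_card_dvd_mul_prime (p := 3) (q := 2)) => //.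
have sAutSym: Aut V \subset perm.Sym_group V^#.
  apply/subsetP=> f AutVf; rewrite inE; apply/subsetP=> x; rewrite inE /= => fx.
  rewrite !inE; apply/andP; split; apply: contraR fx.
    by rewrite negbK => /eqP->; rewrite -(autmE AutVf) morph1.
  by move/(out_Aut AutVf)->.
apply: dvdn_trans (cardSg sAutSym) _; rewrite perm.card_Sym.
by move: leV4; rewrite (cardsD1 1) group1; case: #|_| => [|[|[|[|]]]].
Qed.

Lemma card_quotient_Phi_cyclic_index gT (Q U : {group gT}) p :
    prime p -> p.-group Q -> U \subset Q -> cyclic U ->
  #|Q / 'Phi(Q)| <= p * #|Q : U|.
Proof.
move=> p_pr pQ sUQ cycU; have sUPhi := quotientS 'Phi(Q) sUQ.
rewrite -(Lagrange sUPhi) leq_mul //; last first.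
  by rewrite dvdn_leq ?index_quotient // subIset // gFnorm.
have abelU := abelemS sUPhi (Phi_quotient_abelem pQ).
have := quotient_cyclic 'Phi(Q) cycU; rewrite (abelem_cyclic abelU) => dimU.
rewrite (card_pgroup (abelem_pgroup abelU)) -[leqRHS]expn1.
by rewrite leq_exp2l ?prime_gt1.
Qed.

Lemma rank1_pgroup_cyclic_index2 gT (Q : {group gT}) p :
    p.-group Q -> 'r(Q) <= 1 ->
  cyclic Q
  \/ exists U : {group gT}, [/\ p = 2, U \subset Q, cyclic U & #|Q : U| = 2].
Proof.
move=> pQ rankQ; have [cQQ | not_cQQ] := boolP (abelian Q).
  by left; rewrite abelian_rank1_cyclic.
have [U maxU _]:
  {U : {group gT} | [max U | U <| Q & abelian U] & [1] \subset U}.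
- by apply: maxgroup_exists; rewrite normal1 abelian1.
have scnU := max_SCN pQ maxU; have [nsUQ _] := SCN_P scnU.
have cycU: cyclic U.
  rewrite abelian_rank1_cyclic ?(SCN_abelian scnU) //.
  exact: leq_trans (rankS (normal_sub nsUQ)) rankQ.
have [[p2 iU _] | [M [_ _ _ dimM _]]] := cyclic_SCN pQ scnU not_cQQ cycU.
  by right; exists U; rewrite p2 normal_sub.
have: 1 < 'r_p(Q) by apply/p_rank_geP; exists ('Ohm_1(M))%G.
by rewrite ltnNge -(rank_pgroup pQ) rankQ.
Qed.

Lemma der2_Aut_quotient_Phi_rank1 gT (Q : {group gT}) p :
  p.-group Q -> 'r(Q) <= 1 -> (Aut (Q / 'Phi(Q)))^`(2) = 1.
Proof.
move=> pQ /(rank1_pgroup_cyclic_index2 pQ)[cycQ | [U [p2 sUQ cycU iU]]].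
  have cAA := Aut_cyclic_abelian (quotient_cyclic 'Phi(Q) cycQ).
  by apply/trivgP; rewrite -(derG1P cAA) der_subS.
apply: der2_Aut_card_le4; rewrite p2 in pQ.
have := card_quotient_Phi_cyclic_index (isT : prime 2) pQ sUQ cycU.
by rewrite iU.
Qed.

Lemma der_Aut_cents gT (G V : {group gT}) n :
  G \subset 'N(V) -> (Aut V)^`(n) = 1 -> G^`(n) \subset 'C(V).
Proof.
move=> nVG AutV1; have nVGn := subset_trans (der_sub n G) nVG.
rewrite -ker_conj_aut -sub_morphim_pre // morphim_der // -AutV1 dergS //.
exact: Aut_conj_aut.
Qed.

Lemma der2_sub_Fitting_rank1 gT (G : {group gT}) :
  solvable G -> 'r('F(G)) <= 1 -> G^`(2) \subset 'F(G).
Proof.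
move=> solG rankF.
apply: stab_pcore_Phi_sub_Fitting (der_normal 2 G) _ => // p p_pr.
have rankOp: 'r('O_p(G)) <= 1.
  by apply: leq_trans rankF; rewrite -p_core_Fitting rankS ?pcore_sub.
have nPhiG: G \subset 'N('Phi('O_p(G))) by rewrite !gFnorm_trans ?normG.
rewrite commGC -quotient_cents2 ?gFnorm ?(subset_trans (der_sub 2 G)) //.
rewrite quotient_der // der_Aut_cents ?quotient_norms ?gFnorm //.
exact: der2_Aut_quotient_Phi_rank1 (pcore_pgroup p G) rankOp.
Qed.

End SecondDerivedSubgroup.

Section FittingHeight.

Implicit Type gT : finGroupType.

Lemma fitting_seriesSn n gT (G : {group gT}) :
  fitting_series n.+1 G
    = coset (fitting_series n G) @*^-1 'F(G / fitting_series n G).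
Proof. by []. Qed.

Lemma sub_fitting_seriesS n gT (G A B : {group gT}) :
    A <| G -> B <| G -> A \subset fitting_series n G -> nilpotent (B / A) ->
  B \subset fitting_series n.+1 G.
Proof.
move=> /andP[_ nAG] nsBG; have [sBG _] := andP nsBG.
have [H /andP[_ nHG] defH] := fitting_series_ex G n.
rewrite fitting_seriesSn defH => sAH nilBA.
have [nAB nHB] := (subset_trans sBG nAG, subset_trans sBG nHG).
rewrite -sub_quotient_pre // Fitting_max ?quotient_normal //.
by have /homgP[f /= <-] := homg_quotientS nAB nHB sAH; apply: morphim_nil.
Qed.

Lemma cosetpre_fitting_series n gT (G M : {group gT}) :
    M <| G -> nilpotent M ->
  coset M @*^-1 fitting_series n (G / M) \subset fitting_series n.+1 G.
Proof.
move=> nsMG nilM; elim: n => [|n IHn].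
  have ->: coset M @*^-1 fitting_series 0 (G / M) = M by apply: ker_coset.
  apply: (sub_fitting_seriesS (n := 0) (A := 1)) => //; first exact: normal1.
  exact: quotient_nil.
have [A nsA defA] := fitting_series_ex (G / M) n.
have [B nsB defB] := fitting_series_ex (G / M) n.+1.
have nilBA: nilpotent (B / A).
  by rewrite -defB fitting_seriesSn defA cosetpreK Fitting_nil.
rewrite defA in IHn; rewrite defB.
have [nsAG nsBG]: coset M @*^-1 A <| G /\ coset M @*^-1 B <| G.
  by rewrite -(quotientGK nsMG) !cosetpre_normal.
have [f _ im_f] := third_isom (sub_cosetpre A) nsMG nsAG.
apply: (sub_fitting_seriesS nsAG nsBG IHn).
rewrite -im_f ?(normal_sub nsBG) //; apply: (morphim_nil f).
by rewrite /= !cosetpreK.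
Qed.

Lemma fitting_height_quotient gT (G M : {group gT}) :
    solvable G -> M <| G -> nilpotent M ->
  fitting_height G <= (fitting_height (G / M)).+1.
Proof.
move=> solG nsMG nilM; set n := fitting_height (G / M).
have /eqP GMn: fitting_series n (G / M) == G / M.
  by rewrite -fitting_height_leq ?quotient_sol.
rewrite fitting_height_leq //; have [H nsHG defH] := fitting_series_ex G n.+1.
rewrite eqEsubset defH normal_sub //= -defH.
apply: subset_trans (cosetpre_fitting_series n nsMG nilM).
by rewrite GMn quotientGK.
Qed.

Lemma fitting_height_leq_der n gT (G : {group gT}) :
  G^`(n) = 1 -> fitting_height G <= n.
Proof.
elim: n gT G => [|n IHn] gT G Gn1.
  by rewrite fitting_height_leq (Gn1 : G :=: 1) ?solvable1.
have solG: solvable G by apply/derivedP; exists n.+1.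
have nilGn: nilpotent G^`(n) by apply/abelian_nil/derG1P.
apply: leq_trans (fitting_height_quotient solG (der_normal n G) nilGn) _.
by apply: IHn; rewrite -quotient_der ?gFnorm // trivg_quotient.
Qed.

Lemma fitting_height_rank1_leq4 gT (G M : {group gT}) :
    solvable G -> M <| G -> nilpotent M -> 'r('F(G / M)) <= 1 ->
  fitting_height G <= 4.
Proof.
move=> solG nsMG nilM rankF; have solGM := quotient_sol M solG.
have [nsF nilF] := (Fitting_normal (G / M), Fitting_nil (G / M)).
apply: leq_trans (fitting_height_quotient solG nsMG nilM) _.
apply: leq_trans (fitting_height_quotient solGM nsF nilF) _.
apply: fitting_height_leq_der; rewrite -quotient_der ?gFnorm //.
apply/trivgP; rewrite quotient_sub1 ?der2_sub_Fitting_rank1 //.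
exact: subset_trans (der_sub 2 _) (gFnorm _ _).
Qed.

End FittingHeight.

Section EqualOrderPair.

Variables (gT : finGroupType) (G N : {group gT}).
Hypothesis eopGN : equal_order_pair G N.
Implicit Types P R : {group gT}.

Lemma equal_order_pair_commute_coprime x y :
    x \in G :\: N -> y \in N -> commute x y -> coprime #[x] #[y] -> y = 1.
Proof.
have [_ _ _ eqord] := eopGN.
move=> GNx Ny cxy co_xy; apply/eqP; rewrite -order_eq1.
rewrite -(eqn_pmul2l (order_gt0 x)) muln1 -orderM //.
by apply/eqP/eqord; rewrite // mem_lcoset mulKg.
Qed.

Lemma equal_order_pair_semiregular P R :
    P \subset N -> R \subset G -> R \subset 'N(P) -> coprime #|R| #|P| ->
  semiregular (P / (N :&: R)) (R / (N :&: R)).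
Proof.
have [/andP[_ nNG] _ _ _] := eopGN => sPN sRG nPR coRP.
have nNR := subset_trans sRG nNG.
apply: semiregular_quotient => //; first by rewrite normsI ?normG.
  by rewrite setIC coprime_TIg // (coprimeSg (subsetIr N R)).
move=> x /setDP[Rx notNRx]; apply/trivgP/subsetP=> y /setIP[Py /cent1P cyx].
have notNx: x \notin N by apply: contra notNRx => Nx; rewrite inE Nx.
apply/set1P/(equal_order_pair_commute_coprime _ _ (commute_sym cyx)).
- by rewrite inE notNx (subsetP sRG).
- exact: subsetP Py.
by rewrite (coprime_dvdl (order_dvdG Rx)) // (coprime_dvdr (order_dvdG Py)).
Qed.

Lemma equal_order_pair_p_rank_quotient (r : nat) :
  nilpotent N -> ~~ r.-group N -> 'r_r(G / N) <= 1.
Proof.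
have [nsNG _ _ _] := eopGN => nilN not_rN; have nNG := normal_norm nsNG.
have [R sylR] := Sylow_exists r G; have [sRG rR _] := and3P sylR.
have nNR := subset_trans sRG nNG.
rewrite -(p_rank_Sylow (quotient_pHall nNR sylR)).
rewrite -(isog_p_rank (second_isog nNR)).
pose K := (N :&: R)%G; pose P := 'O_r^'(N)%G.
have sPN: P \subset N := pcore_sub _ _.
have coRP: coprime #|R| #|P| := pnat_coprime rR (pcore_pgroup _ _).
have coKP: coprime #|K| #|P| := coprimeSg (subsetIr N R) coRP.
have nPR: R \subset 'N(P) := gFnorm_trans _ nNR.
have nKP: P \subset 'N(K).
  by rewrite cents_norm // (sub_nilpotent_cent2 nilN) ?subsetIl.
have ntP: P :!=: 1.
  apply: contraNneq not_rN => /= P1.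
  have [_ <- _ _] := dprodP (nilpotent_pcoreC r nilN).
  by rewrite P1 mulg1 pcore_pgroup.
apply: leq_trans (p_rank_le_rank r _) _.
apply: (semiregular_rank (K := P / K)).
- exact: quotient_sol (solvableS sPN (nilpotent_sol nilN)).
- by rewrite -(isog_eq1 (quotient_isog nKP _)) ?coprime_TIg.
- exact: quotient_norms.
exact: equal_order_pair_semiregular.
Qed.

Lemma equal_order_pair_rank_Fitting_quotient :
  nilpotent N -> ~~ p_group N -> 'r('F(G / N)) <= 1.
Proof.
move=> nilN not_pN; have [r _ ->] := rank_witness 'F(G / N).
apply: leq_trans (p_rankS r (Fitting_sub _)) _.
apply: equal_order_pair_p_rank_quotient nilN _.
by apply: contra not_pN; apply: pgroup_p.
Qed.

Lemma equal_order_pair_rank_Fitting_quotient_pcore (p : nat) :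
  p.-group N -> 'r('F(G / 'O_p(G))) <= 1.
Proof.
have [nsNG _ ntN _] := eopGN => pN.
have [r _ ->] := rank_witness 'F(G / 'O_p(G)).
have [-> | neq_rp] := eqVneq r p.
  rewrite -(p_rank_Sylow (nilpotent_pcore_Hall p (Fitting_nil _))).
  by rewrite /= p_core_Fitting trivg_pcore_quotient p_rank1.
have r'p (H : {group gT}) : p.-group H -> r^'.-group H.
  by move=> pH; apply: pi_pgroup pH _; rewrite !inE eq_sym.
apply: leq_trans (p_rankS r (Fitting_sub _)) _.
rewrite p_rank_p'quotient ?r'p ?pcore_pgroup ?gFnorm //.
rewrite -(p_rank_p'quotient (r'p N pN) (normal_norm nsNG)).
apply: equal_order_pair_p_rank_quotient (pgroup_nil pN) _.
apply: contra ntN => rN.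
by rewrite trivg_card1 (pnat_1 rN (r'p N pN)).
Qed.

End EqualOrderPair.

Theorem proposition5p3 (gT : finGroupType) (G N : {group gT}) :
  equal_order_pair G N -> solvable G -> nilpotent N -> fitting_height G <= 4.
Proof.
move=> eopGN solG nilN; have [nsNG _ _ _] := eopGN.
have [/p_groupP[p _ pN] | not_pN] := boolP (p_group N); last first.
  apply: (fitting_height_rank1_leq4 solG nsNG nilN).
  exact: equal_order_pair_rank_Fitting_quotient.
apply: fitting_height_rank1_leq4 solG (pcore_normal p G) _ _.
  exact: pgroup_nil (pcore_pgroup p G).
exact: (equal_order_pair_rank_Fitting_quotient_pcore eopGN pN).
Qed.
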